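(* For each integer $d\geq 3$, \[\Big[\,3-\frac{d}{(d-1)^2}\,,\,+\infty\Big]\subset\Omega_d .\]
   Context: For $\mathbf x=(x_1,\dots,x_d)\in\mathbb R^d$ let $\Pi(\mathbf x)=\prod_{i=1}^d|x_i|^{1/d}$, and let $|\cdot|$ denote the Euclidean norm. For a full-rank lattice $\Lambda\subset\mathbb R^d$ its Diophantine exponent is \[\omega(\Lambda)=\sup\{\gamma\in\mathbb R:\ \Pi(\mathbf x)\leq|\mathbf x|^{-\gamma}\text{ for infinitely many }\mathbf x\in\Lambda\}\in[0,+\infty].\] Let $\mathcal L_d$ be the space of full-rank lattices in $\mathbb R^d$ of covolume $1$, and $\Omega_d=\{\omega(\Lambda):\Lambda\in\mathcal L_d\}$ (a subset of $[0,+\infty]$; the interval in the claim includes the value $+\infty$). *)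

(* Defs.v *)
From HB Require Import structures.
From mathcomp Require Import all_boot all_order all_algebra.
From mathcomp Require Import all_classical all_reals all_analysis.
Set Implicit Arguments. Unset Strict Implicit. Unset Printing Implicit Defensive.
Import Order.TTheory GRing.Theory Num.Theory.
Local Open Scope classical_set_scope.
Local Open Scope ring_scope.

Definition lattice (R : realType) (d : nat) (B : 'M[R]_d) : set 'rV[R]_d :=
  [set x | exists z : 'rV[int]_d, x = (map_mx (fun k : int => k%:~R) z) *m B].

Definition Pi (R : realType) (d : nat) (x : 'rV[R]_d) : R :=
  \prod_(i < d) (`|x 0 i| `^ (d%:R^-1)).

Definition eucl (R : realType) (d : nat) (x : 'rV[R]_d) : R :=
  Num.sqrt (\sum_(i < d) (x 0 i) ^+ 2).

Definition dioph_exp (R : realType) (d : nat) (L : set 'rV[R]_d) : \bar R :=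
  ereal_sup [set g%:E | g in
    [set g : R | ~ finite_set [set x | L x /\ Pi x <= eucl x `^ (- g)]]].

Definition Omega (R : realType) (d : nat) : set (\bar R) :=
  [set dioph_exp (lattice B) | B in [set B : 'M[R]_d | `|\det B| = 1]].

(* Main.v *)
Require Import Defs.
From HB Require Import structures.
From mathcomp Require Import all_boot all_order all_algebra.
From mathcomp Require Import all_classical all_reals all_analysis.
From mathcomp Require polyrcf.
From mathcomp Require Import zify ring lra.
Import Order.TTheory GRing.Theory Num.Theory.
Local Open Scope classical_set_scope.
Local Open Scope ring_scope.

(** Let theta_1, ..., theta_d be the roots of a totally real irreducible monic
integer polynomial of degree d, and L_i(z) = sum_j z_j theta_i^j the conjugates
of the corresponding form, so that |prod_i L_i(z)| >= 1 for integral z <> 0 and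
hence prod_{i>=2} |L_i(z)| >> |z|^-1.  Replace L_1 by
L'(z) = z_0 - xi z_1 + a_2 z_2 + ... + a_{d-1} z_{d-1}, where
- xi has rational approximations p_k/q_k with |q_k xi - p_k| of exact order
  q_k^-(dw+d-1), and |q xi - p| >> q^-2 for (p, q) off the multiples of
  (p_k, q_k);
- the a_j are generic (Borel-Cantelli), so that |L'(z)| >> |z|^-(d+2) unless
  z_2 = ... = z_{d-1} = 0.
At z = (p_k, q_k, 0, ..., 0) the product L' L_2 ... L_d has order |z|^-dw; at
integral z off the lines through these points it is >> |z|^-(d+3), which is no
smaller since dw >= d + 3 in the given range of w. *)

(** * Generic coefficients by a measure argument *)

(** The open intervals have total length at most 1/2, so by countable subadditivity they cannot
    cover [[M, M + 1]], which has length 1. *)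
Lemma avoid_balls (R : realType) (M : R) (s : nat -> seq R) (r : nat -> R) :
  (forall n, 0 <= r n) ->
  (forall N, \sum_(n < N) (size (s n))%:R * (r n *+ 2) <= 1 / 2) ->
  exists t, M <= t <= M + 1 /\ forall n, {in s n, forall c, r n <= `|c - t|}.
Proof.
move=> r0 sumle.
pose I (c e : R) : set R := `]c - e, c + e[%classic.
pose F n := \big[setU/set0]_(c <- s n) I c (r n).
have muI (c e : R) : 0 <= e ->
    (lebesgue_measure (I c e) <= (e *+ 2)%:E)%E.
  move=> e0; rewrite /I lebesgue_measure_itv /= lte_fin.
  case: ifP => _; last by rewrite lee_fin mulrn_wge0.
  by rewrite -EFinB lee_fin; lra.
have mF n : measurable (F n).
  by apply: bigsetU_measurable => c _; exact: measurable_itv.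
have muF n : (lebesgue_measure (F n) <= ((size (s n))%:R * (r n *+ 2))%:E)%E.
  rewrite /F; elim: (s n) => [|c l IH].
    by rewrite big_nil measure0 mul0r.
  rewrite big_cons; apply: le_trans (measureU2 _ _ _) _.
  - exact: measurable_itv.
  - by apply: bigsetU_measurable => e _; exact: measurable_itv.
  - rewrite /= -natr1 mulrDl mul1r EFinD addeC.
      by apply: leeD => //; exact: muI.
have [sub|] := pselect (`[M, M + 1]%classic `<=` \bigcup_n F n).
  have h1 : (1%:E <= \sum_(n <oo) lebesgue_measure (F n))%E.
    have <- : lebesgue_measure (`[M, M + 1]%classic : set R) = 1%:E.
      rewrite lebesgue_measure_itv /= lte_fin ltrDl ltr01 -EFinB.
      by congr EFin; ring.
    exact: (measure_sigma_subadditive lebesgue_measure mF _ sub).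
  have : (1%:E <= (1 / 2 : R)%:E)%E.
    apply: le_trans h1 _; apply: lime_le.
      by apply: is_cvg_nneseries => n _ _; exact: measure_ge0.
    apply: nearW => N.
    rewrite big_mkord; apply: (@le_trans _ _ (\sum_(n < N) ((size (s n))%:R * (r n *+ 2))%:E)%E).
      by apply: lee_sum => i _; exact: muF.
    by rewrite sumEFin lee_fin.
  rewrite lee_fin; lra.
move=> nsub; have /existsNP[t /not_implyP[tI tF]] := nsub.
exists t; split; first by move: tI; rewrite /= in_itv.
move=> n c cs; rewrite leNgt; apply/negP => ct; apply: tF; exists n => //.
rewrite /F -bigcup_seq; exists c => //=.
by rewrite /I /= in_itv /= -ltr_distl distrC.
Qed.

Lemma sum_inv_sqr_le2 (R : realFieldType) (N : nat) :
  \sum_(n < N) (n.+1%:R ^+ 2)^-1 <= 2 :> R.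
Proof.
(* Sharpening the bound to [2 - 1/N] lets the induction telescope; at [N = 0] the inverse is 0. *)
suff : \sum_(n < N) (n.+1%:R ^+ 2)^-1 <= 2 - N%:R^-1 :> R.
  move=> h; apply: le_trans h _; rewrite gerBl invr_ge0; exact: ler0n.
elim: N => [|[|N] IH]; first by rewrite big_ord0 invr0 subr0.
  by rewrite big_ord1 expr1n invr1; lra.
rewrite big_ord_recr /=; apply: le_trans (lerD IH (lexx _)) _.
have N0 : 0 < N.+1%:R :> R by rewrite ltr0n.
have -> : N.+2%:R = N.+1%:R + 1 :> R by rewrite -natr1.
set x := _%:R in N0 *; have x1 : 0 < x + 1 by lra.
rewrite -subr_ge0.
have -> : 2 - (x + 1)^-1 - (2 - x^-1 + ((x + 1) ^+ 2)^-1) = (x * (x + 1) ^+ 2)^-1.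
  by field; rewrite ?lt0r_neq0.
by rewrite invr_ge0 mulr_ge0 ?ltW// exprn_gt0.
Qed.

(** For fixed [z] with [z j != 0] the form is small only if [t] is close to its zero in [t]. At
    height [T] there are at most [(3 T) ^ d] vectors, so the intervals to be avoided have total
    length at most the sum of [1 / (4 T ^ 2)], hence at most 1/2. The parameter [M] lets [t] be
    forced above a given bound. *)
Lemma exists_generic_coeff (R : realType) (d : nat) (a : 'I_d -> R) (j : 'I_d)
    (M : R) :
  exists t, M <= t /\ forall (T : nat) (z : 'I_d -> int),
    z j != 0 -> (forall i, (`|z i| <= T)%N) ->
    (8 * 3 ^+ d * T%:R ^+ d.+2)^-1
      <= `|\sum_i (if i == j then t else a i) * (z i)%:~R|.
Proof.
(* [zof n] decodes [f] as a vector with entries between [-(n + 1)] and [n + 1]. When the entry at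
   [j] is 0, the corresponding centre in [s n] is 0, by the convention on division. *)
pose zof n (f : {ffun 'I_d -> 'I_(2 * n.+1).+1}) i : int := (f i : nat)%:Z - n.+1%:Z.
pose s n := [seq - (\sum_(i | i != j) a i * (zof n f i)%:~R) / (zof n f j)%:~R
            | f <- enum {ffun 'I_d -> 'I_(2 * n.+1).+1}].
pose r n : R := (8 * 3 ^+ d * n.+1%:R ^+ d.+2)^-1.
have r0 n : 0 <= r n by rewrite invr_ge0; apply: mulr_ge0; [apply: mulr_ge0|apply: exprn_ge0] => //; apply: exprn_ge0.
have [|t [/andP[Mt _] tP]] := avoid_balls R M s r r0.
  move=> N.
  apply: (@le_trans _ _ (\sum_(n < N) 4^-1 * (n.+1%:R ^+ 2)^-1)); last first.
    by rewrite -mulr_sumr; have := sum_inv_sqr_le2 R N; lra.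
  apply: ler_sum => n _.
  have -> : (size (s n))%:R = (2 * n.+1).+1%:R ^+ d :> R.
    by rewrite size_map -cardE card_ffun !card_ord natrX.
  apply: (@le_trans _ _ ((3 * n.+1%:R) ^+ d * (r n *+ 2))).
    apply: ler_wpM2r; first by rewrite mulrn_wge0.
    apply: lerXn2r; rewrite ?nnegrE ?mulr_ge0 //.
    by rewrite -natrM ler_nat; lia.
  rewrite /r exprMn -[d.+2]addn2 (exprD _ d 2).
  have : n.+1%:R != 0 :> R by rewrite pnatr_eq0.
  move: (n.+1%:R) => x x0.
  have : (3 ^+ d : R) != 0 by rewrite expf_neq0 // pnatr_eq0.
  have : x ^+ d != 0 by rewrite expf_neq0.
  move: (3 ^+ d) (x ^+ d) => u v v0 u0.
  rewrite le_eqVlt; apply/orP; left; apply/eqP.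
  by field; rewrite x0 u0 v0.
exists t; split => // T z zj zT.
have T0 : (0 < T)%N by move: (zT j); rewrite -absz_gt0 in zj; lia.
case: T T0 zT => // n _ zT.
have zb i : (`|(z i + n.+1%:Z)%R| < (2 * n.+1).+1)%N by move: (zT i); lia.
pose f : {ffun 'I_d -> 'I_(2 * n.+1).+1} := [ffun i => Ordinal (zb i)].
have zofE i : zof n f i = z i by rewrite /zof ffunE /=; move: (zT i); lia.
have h : r n <= `|- (\sum_(i | i != j) a i * (zof n f i)%:~R) / (zof n f j)%:~R - t|.
  by apply: tP; apply/mapP; exists f => //; rewrite mem_enum.
apply: le_trans h _; rewrite zofE.
rewrite [in leRHS](bigD1 j) //= eqxx.
under [X in _ <= `|_ + X|]eq_bigr => i ij do rewrite (negbTE ij) -zofE.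
set S := \sum_(i | _) _; set y : R := (z j)%:~R.
have y1 : 1 <= `|y| by rewrite /y -intr_norm ler1z; lia.
have y0 : y != 0 by rewrite -normr_gt0; lra.
have -> : t * y + S = - ((- S / y - t) * y) by field.
by rewrite normrN normrM ler_peMr.
Qed.

(** The coefficients of index at least 2 are chosen one after the other. A vector [z] is dealt with
    at its last nonzero index, as later coefficients do not change the form at [z]. Each new
    coefficient is also taken large enough that the partial sum of [a i * v i] plus this coefficient
    is at least 1; at the last index, where [v] is 1, this gives the nonvanishing. *)
Lemma exists_generic_form (R : realType) (m : nat) (a0 v : 'I_m.+1 -> R) :
  (2 <= m)%N -> v ord_max = 1 ->
  exists a : 'I_m.+1 -> R, [/\ forall i : 'I_m.+1, (i < 2)%N -> a i = a0 i,
    \sum_i a i * v i != 0 &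
    forall (T : nat) (z : 'I_m.+1 -> int),
      (exists2 j : 'I_m.+1, (2 <= j)%N & z j != 0) ->
      (forall i, (`|z i| <= T)%N) ->
      (8 * 3 ^+ m.+1 * T%:R ^+ m.+3)^-1 <= `|\sum_i a i * (z i)%:~R|].
Proof.
move=> m2 v1.
have H k : (k <= m.+1)%N -> exists a : 'I_m.+1 -> R,
    (forall i : 'I_m.+1, (i < 2)%N -> a i = a0 i) /\
    forall j : 'I_m.+1, (2 <= j < k)%N ->
      1 <= \sum_(i < m.+1 | (i < j)%N) a i * v i + a j /\
      forall (T : nat) (z : 'I_m.+1 -> int), z j != 0 ->
        (forall i : 'I_m.+1, (j < i)%N -> z i = 0) ->
        (forall i, (`|z i| <= T)%N) ->
        (8 * 3 ^+ m.+1 * T%:R ^+ m.+3)^-1 <= `|\sum_i a i * (z i)%:~R|; last first.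
  have [a [aE aP]] := H m.+1 (leqnn _).
  exists a; split => //.
    have [|h _] := aP ord_max; first by rewrite /= m2 /=.
    suff -> : \sum_i a i * v i =
        \sum_(i < m.+1 | (i < @ord_max m)%N) a i * v i + a ord_max.
      by apply: lt0r_neq0; apply: lt_le_trans ltr01 h.
    rewrite (bigD1 ord_max) //= v1 mulr1 addrC; congr (_ + _).
    apply: eq_bigl => i; have := ltn_ord i.
    by rewrite -val_eqE /=; lia.
  move=> T z [j j2 zj] zT.
  pose P (i : 'I_m.+1) := z i != 0.
  case: (@arg_maxnP _ j P (fun i => nat_of_ord i) zj) => l Pl lmax.
  apply: (aP l _).2 => //.
    by have := lmax _ zj; have := ltn_ord l; move=> /=; lia.
  move=> i li; apply/eqP; apply: contraTT li => zi.
  by rewrite -leqNgt; exact: lmax.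
elim: k => [|k IH] km.
  by exists a0; split => // j; lia.
have [a [aE aP]] := IH (ltnW km).
have [k2|k2] := ltnP k 2.
  by exists a; split => // j; lia.
pose jk := Ordinal km.
have [t [Mt tP]] := exists_generic_coeff R m.+1 a jk
   (1 - \sum_(i < m.+1 | (i < jk)%N) a i * v i).
exists (fun i => if i == jk then t else a i); split => [i i2|j jk1].
  by case: eqP => [ij|_]; [move: i2; rewrite ij /=; lia|exact: aE].
have sumE : \sum_(i < m.+1 | (i < j)%N) (if i == jk then t else a i) * v i =
    \sum_(i < m.+1 | (i < j)%N) a i * v i.
  apply: eq_bigr => i ij; case: eqP => // ijk.
  by move: ij; rewrite ijk /=; lia.
rewrite sumE; have [jE|jne] := eqVneq j jk.
  rewrite jE; split; first by move: Mt; lra.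
  by move=> T z z0 _ zT; exact: tP.
have jk0 : (2 <= j < k)%N by move: jne jk1; rewrite -val_eqE /=; lia.
have [h1 h2] := aP j jk0; split => // T z zj z0 zT.
have := h2 T z zj z0 zT; congr (_ <= `|_|).
apply: eq_bigr => i _; case: eqP => // ->.
by rewrite z0 ?mulr0 //=; lia.
Qed.

(** * Real numbers with prescribed rational approximations *)

Lemma exists_lacunary_number (R : realType) (n : nat -> nat) :
  n 0%N = 1%N -> (forall k, (2 * n k <= n k.+1)%N) ->
  exists (xi : R) (p : nat -> nat), forall k,
    [/\ odd (p k), (p k < 2 ^ n k)%N &
      (2 ^ n k.+1)%:R^-1 <= xi - (p k)%:R / (2 ^ n k)%:R <= 2 / (2 ^ n k.+1)%:R].
Proof.
move=> n0 nS.
have n1 k : (0 < n k)%N by elim: k => [|k IH]; [rewrite n0|have := nS k; lia].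
have q2 k : (2 * 2 ^ n k <= 2 ^ n k.+1)%N.
  by rewrite -expnS leq_exp2l //; have := nS k; have := n1 k; lia.
(* [xi] is the sum of the [2 ^- n k]; the numerators [p k] of its partial sums
   are odd, so [p k / 2 ^ n k] is in lowest terms. *)
pose p := nat_rect (fun=> nat) 1%N (fun k pk => pk * 2 ^ (n k.+1 - n k) + 1)%N.
pose s k : R := (p k)%:R / (2 ^ n k)%:R.
have q0 k : 0 < (2 ^ n k)%:R :> R by rewrite ltr0n expn_gt0.
have qE k : (2 ^ n k.+1 = 2 ^ (n k.+1 - n k) * 2 ^ n k)%N.
  by rewrite -expnD subnK //; have := nS k; lia.
have sS k : s k.+1 = s k + (2 ^ n k.+1)%:R^-1.
  rewrite /s /= natrD natrM mulrDl mul1r; congr (_ + _).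
  rewrite [in LHS]qE natrM invfM mulrA mulfK // lt0r_neq0 // ltr0n expn_gt0 //.
have podd k : odd (p k) && (p k < 2 ^ n k)%N.
  elim: k => [|k /andP[_ IH]] /=; first by rewrite n0.
  have h : (1 < 2 ^ (n k.+1 - n k))%N.
    by rewrite -{1}(expn0 2) ltn_exp2l //; have := nS k; have := n1 k; lia.
  rewrite oddD oddM oddX /=; apply/andP; split.
    have -> : (n k.+1 - n k == 0)%N = false by have := nS k; have := n1 k; lia.
    by rewrite andbF.
  by rewrite [in X in (_ < X)%N]qE; nia.
have iq k : 2 / (2 ^ n k.+1)%:R <= (2 ^ n k)%:R^-1 :> R.
  rewrite ler_pdivrMr // mulrC ler_pdivlMr // -natrM ler_nat; exact: q2.
have smono k l : (k <= l)%N -> s k <= s l.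
  move=> /subnK <-; elim: (l - k)%N => [//|i IH].
  by rewrite addSn sS; apply: le_trans IH _; rewrite lerDl invr_ge0 ltW.
(* [s] increases and [u] decreases, so the supremum of [s] lies in every interval from [s k] to
   [u k]; the lower estimate for [xi] comes from [s k.+1]. *)
pose u k := s k + 2 / (2 ^ n k.+1)%:R.
have umono k l : (k <= l)%N -> u l <= u k.
  move=> /subnK <-; elim: (l - k)%N => [//|i IH].
  rewrite addSn; apply: le_trans IH; rewrite /u sS.
  by have := iq (i + k).+1; lra.
have su k l : s k <= u l.
  apply: (@le_trans _ _ (s (maxn k l))); first by apply: smono; exact: leq_maxl.
  apply: (@le_trans _ _ (u (maxn k l))); last by apply: umono; exact: leq_maxr.
  by rewrite /u lerDl divr_ge0 // ltW.
have hs : has_ubound (range s) by exists (u 0%N) => _ [k _ <-].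
exists (sup (range s)), p => k; have /andP[-> ->] := podd k; split=> //.
rewrite -/(s k); apply/andP; split.
  have : s k.+1 <= sup (range s) by apply: ub_le_sup => //; exists k.+1.
  by rewrite sS; lra.
have : sup (range s) <= u k.
  by apply: ge_sup; [exists (s 0%N); exists 0%N|move=> _ [l _ <-]].
by rewrite /u; lra.
Qed.

(** Write [q_k] for [2 ^ n k]. If [x / y] is no [p k / q_k], take the first [k] with
    [4 |y| q_k <= q_(k+1)]: then [|x - y p_k / q_k| >= 1 / q_k], while replacing [p_k / q_k] by [xi]
    costs at most [1 / (2 q_k)]. Minimality of [k], together with [q_(k-1) ^ 3 <= q_k], bounds [q_k]
    in terms of [T]. *)
Lemma lacunary_number_approx (R : realType) (n p : nat -> nat) (xi : R) :
  n 0%N = 1%N -> (forall k, (3 * n k <= n k.+1)%N) ->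
  (forall k, [/\ odd (p k), (p k < 2 ^ n k)%N &
     (2 ^ n k.+1)%:R^-1 <= xi - (p k)%:R / (2 ^ n k)%:R <= 2 / (2 ^ n k.+1)%:R]) ->
  forall (x y : int) (T : nat), (`|y| <= T)%N ->
    (exists k (m : int), x = m * (p k)%:Z /\ y = m * (2 ^ n k)%N%:Z) \/
    (32 * T%:R ^+ 2)^-1 <= `|x%:~R - y%:~R * xi|.
Proof.
move=> n0 nS hxi x y T yT.
have [[k xk]|nk] := pselect (exists k, x * (2 ^ n k)%N%:Z = y * (p k)%:Z).
  left; exists k; have [pk _ _] := hxi k.
  have co : coprimez (2 ^ n k)%N%:Z (p k)%:Z.
    by rewrite /coprimez /gcdz !absz_nat eqz_nat; apply: coprimeXl; rewrite coprime2n.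
  have : ((2 ^ n k)%N%:Z %| y)%Z.
    by rewrite -(Gauss_dvdzl _ co) -xk dvdz_mull.
  case/dvdzP => m ym; exists m; split=> //.
  have q0 : (2 ^ n k)%N%:Z != 0 by rewrite eqz_nat expn_eq0.
  by apply: (mulIf q0); rewrite xk ym; ring.
right.
have nk1 k : (k < n k)%N by elim: k => [|k IH]; [rewrite n0|have := nS k; lia].
have [K hK] : exists k, (4 * `|y| * 2 ^ n k <= 2 ^ n k.+1)%N.
  exists (4 * `|y|)%N.
  set k := (4 * `|y|)%N.
  apply: (@leq_trans (2 ^ k * 2 ^ n k)).
    by rewrite leq_mul2r; apply/orP; right; apply: ltnW; apply: ltn_expl.
  by rewrite -expnD leq_exp2l //; have := nk1 k; have := nS k; lia.
pose P k := (4 * `|y| * 2 ^ n k <= 2 ^ n k.+1)%N.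
have exP : exists k, P k by exists K.
case: (ex_minnP exP) => k Pk kmin.
have q0 i : 0 < (2 ^ n i)%:R :> R by rewrite ltr0n expn_gt0.
have main : (2 * (2 ^ n k)%:R)^-1 <= `|x%:~R - y%:~R * xi|.
  have [_ _ /andP[l1 l2]] := hxi k.
  set q : R := (2 ^ n k)%:R in l1 l2 *; set q' : R := (2 ^ n k.+1)%:R in l1 l2 *.
  have [qq qq'] : 0 < q /\ 0 < q' by split; exact: q0.
  set e := xi - (p k)%:R / q in l1 l2.
  have e0 : 0 <= e by apply: le_trans l1; rewrite invr_ge0 ltW.
  have -> : x%:~R - y%:~R * xi = (x%:~R - y%:~R * ((p k)%:R / q)) - y%:~R * e.
    by rewrite /e; ring.
  have h1 : q^-1 <= `|x%:~R - y%:~R * ((p k)%:R / q)|.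
    have -> : x%:~R - y%:~R * ((p k)%:R / q) = (x * (2 ^ n k)%N%:Z - y * (p k)%:Z)%:~R / q.
      rewrite rmorphB /= !rmorphM /= -/q.
      by field; rewrite lt0r_neq0.
    rewrite normrM normfV (ger0_norm (ltW qq)) ler_peMl ?invr_ge0 ?(ltW qq) //.
    rewrite -intr_norm ler1z -gtz0_ge1 normr_gt0 subr_eq0.
    by apply/eqP => h; apply: nk; exists k.
  have h2 : `|y%:~R * e| <= (2 * q)^-1.
    rewrite normrM (ger0_norm e0).
    apply: (@le_trans _ _ (`|y%:~R| * (2 / q'))); first by apply: ler_wpM2l.
    rewrite -[leRHS]div1r mulrA ler_pdivrMr // mulrAC ler_pdivlMr ?mulr_gt0 //.
    have : 4 * `|y%:~R| * q <= q' :> R.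
      by rewrite -intr_norm -natr_absz -!natrM ler_nat.
    lra.
  apply: le_trans (lerB_dist _ _).
  have -> : (2 * q)^-1 = q^-1 - (2 * q)^-1 by field; rewrite lt0r_neq0.
  by apply: lerB.
apply: le_trans main.
(* For [T = 0] the bound to prove is the inverse of 0, that is 0. *)
have [T0|T0] := posnP T.
  by rewrite T0 expr0n /= mulr0 invr0 invr_ge0 mulr_ge0 // ltW.
rewrite lef_pV2 ?posrE ?mulr_gt0 ?exprn_gt0 ?ltr0n ?expn_gt0 //.
rewrite -natrX -!natrM ler_nat.
case: k Pk kmin => [|k] Pk kmin; first by rewrite n0; nia.
have : ~~ P k by apply/negP => /kmin; lia.
rewrite /P -ltnNge => h.
have : (2 ^ n k * 2 ^ n k * 2 ^ n k <= 2 ^ n k.+1)%N.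
  by rewrite -!expnD leq_exp2l //; have := nS k; lia.
have : (0 < 2 ^ n k)%N by rewrite expn_gt0.
move: (2 ^ n k)%N (2 ^ n k.+1)%N h => a b h a0 ab.
have aT : (a * a < 4 * T)%N by nia.
nia.
Qed.

(** With [q k = 2 ^ n k] and [n k.+1] the ceiling of [(b + 1) * n k], the number [q k.+1] agrees
    with [q k] to the power [b + 1] up to a factor 2, so [q k * xi - p k], of order [q k / q k.+1],
    has order [q k] to the power [-b]. The assumption [2 <= b] gives the growth
    [3 * n k <= n k.+1]. *)
Lemma exists_approximable_number (R : realType) (b : R) : 2 <= b ->
  exists (xi : R) (p q : nat -> nat),
  [/\ forall k, (p k <= q k)%N, forall k, (k < q k)%N,
   forall k, (q k)%:R `^ (- b) / 2 <= (q k)%:R * xi - (p k)%:R <= 2 * (q k)%:R `^ (- b)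
   & forall (x y : int) (T : nat), (`|y| <= T)%N ->
    (exists k (m : int), x = m * (p k)%:Z /\ y = m * (q k)%:Z) \/
    (32 * T%:R ^+ 2)^-1 <= `|x%:~R - y%:~R * xi|].
Proof.
move=> b2.
pose N (l : nat) := `|Num.ceil ((b + 1) * l%:R)|%N.
have NP l : (b + 1) * l%:R <= (N l)%:R < (b + 1) * l%:R + 1.
  have h0 : 0 <= (b + 1) * l%:R by rewrite mulr_ge0 //; lra.
  have c0 : 0 <= Num.ceil ((b + 1) * l%:R) by rewrite ceil_ge0; lra.
  have -> : (N l)%:R = (Num.ceil ((b + 1) * l%:R))%:~R :> R.
    by rewrite /N natr_absz ger0_norm.
  have /andP[h1 h2] := ceil_itv ((b + 1) * l%:R).
  by rewrite h2 /=; move: h1; rewrite intrB; lra.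
pose n k := iter k N 1%N.
have nS k : (3 * n k <= n k.+1)%N.
  rewrite -(ler_nat R) natrM /=; have /andP[h _] := NP (n k).
  apply: le_trans h; apply: ler_wpM2r => //; lra.
have [|xi [p hp]] := exists_lacunary_number R n erefl.
  by move=> k; have := nS k; lia.
exists xi, p, (fun k => 2 ^ n k)%N; split.
- by move=> k; have [_ /ltnW] := hp k.
- move=> k; apply: (@leq_ltn_trans (n k)); last exact: ltn_expl.
  elim: k => [//|k IH]; have := nS k.
  by case: k IH => [|k] IH; rewrite /= in IH *; lia.
- move=> k; have [_ _] := hp k.
  have q0 : 0 < (2 ^ n k)%:R :> R by rewrite ltr0n expn_gt0.
  have powE : (2 ^ n k)%:R `^ b = 2 `^ (b * (n k)%:R) :> R.
    by rewrite mulrC powRrM powR_mulrn // natrX.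
  have qE : (2 ^ n k.+1)%:R = 2 `^ (n k.+1)%:R :> R by rewrite powR_mulrn // natrX.
  have qkE : (2 ^ n k)%:R = 2 `^ (n k)%:R :> R by rewrite powR_mulrn // natrX.
  have b0 : 0 < 2 `^ (b * (n k)%:R) :> R by apply: powR_gt0.
  have l1 : (2 ^ n k)%:R * 2 `^ (b * (n k)%:R) <= (2 ^ n k.+1)%:R :> R.
    rewrite qE qkE -powRD; last by apply/implyP => _; rewrite pnatr_eq0.
    by apply: ler_powR; [rewrite ler1n|have /andP[h _] := NP (n k); rewrite /=; lra].
  have l2 : (2 ^ n k.+1)%:R <= 2 * ((2 ^ n k)%:R * 2 `^ (b * (n k)%:R)) :> R.
    rewrite qE qkE -powRD; last by apply/implyP => _; rewrite pnatr_eq0.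
    rewrite -[X in _ <= X * _](@powRr1 _ 2) // -powRD; last by apply/implyP => _; rewrite pnatr_eq0.
    by apply: ler_powR; [rewrite ler1n|have /andP[_ h] := NP (n k); rewrite /=; lra].
  have q1 : 0 < (2 ^ n k.+1)%:R :> R by rewrite ltr0n expn_gt0.
  rewrite powRN powE.
  move: q0 q1 b0 l1 l2; set q := (2 ^ n k)%:R; set q' := (2 ^ n k.+1)%:R; set B := 2 `^ _.
  move=> q0 q1 b0 l1 l2 /andP[h1 h2].
  have e1 : q * xi - (p k)%:R = q * (xi - (p k)%:R / q) by field; rewrite lt0r_neq0.
  rewrite e1; apply/andP; split.
    apply: (@le_trans _ _ (q * q'^-1)); last by rewrite ler_pM2l.
    by rewrite ler_pdivlMr // mulrAC ler_pdivrMr // ler_pdivrMl //; lra.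
  apply: (@le_trans _ _ (q * (2 / q'))); first by rewrite ler_pM2l.
  by rewrite mulrA ler_pdivrMr // mulrAC ler_pdivlMr //; lra.
- exact: lacunary_number_approx.
Qed.

(** * A totally real irreducible polynomial and its norm form *)

Lemma exists_irreducible_totally_real (R : rcfType) (d : nat) : (2 <= d)%N ->
  exists (f : {poly int}) (theta : 'I_d -> R),
    [/\ f \is monic, size f = d.+1, irreducible_poly f, injective theta &
      forall i, 0 < theta i /\ root (map_poly intr f) (theta i)].
Proof.
move=> d2.
(* Eisenstein at 2 for [prod_(j < d) (X - 4 (j + 1)) + 2], whose sign changes
   between consecutive points 4 i + 2. *)
pose h e : {poly int} := \prod_(j < e) ('X - ((4 * j.+1)%N%:Z)%:P).
have hS e : h e.+1 = h e * 'X - h e * ((4 * e.+1)%N%:Z)%:P.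
  by rewrite /h big_ord_recr /= mulrBr.
(* Modulo 4 the polynomial [h e] is [X ^ e], so the constant term of [f] is 2 modulo 4. *)
have h4 e k : (k < e)%N -> (4 %| (h e)`_k)%Z.
  elim: e k => [//|e IH] k ke; rewrite hS coefB coefMX coefMC.
  apply: rpredB.
    by case: k ke => [|k] ke //=; apply: IH.
  by apply: dvdz_mull; rewrite PoszM dvdz_mulr.
have hm e : h e \is monic by apply: monic_prod_XsubC.
have sh e : size (h e) = e.+1.
  by rewrite /h size_prod_XsubC /index_enum -enumT size_enum_ord.
pose f := h d + 2%:P.
have sf : size f = d.+1.
  by rewrite /f size_polyDl sh // size_polyC //=; lia.
have cf k : f`_k = (h d)`_k + (if k == 0%N then 2 else 0) by rewrite coefD coefC.
have fm : f \is monic.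
  by rewrite monicE lead_coefE sf cf /=; have := monicP (hm d);
     rewrite lead_coefE sh /= => ->; case: (d) d2.
have fi : irreducible_poly f.
  apply: (@eisenstein_crit 2) => //.
  - by rewrite sf; lia.
  - by rewrite (monicP fm).
  - rewrite cf /=; apply/negP => h0.
    have /dvdzP[l hl] : (4 %| (h d)`_0)%Z by apply: h4; lia.
    by case/dvdzP: h0 => k; rewrite hl expr2; lia.
  - rewrite sf /= => i id; rewrite cf; apply: rpredD; last by case: eqP.
    by apply: dvdz_trans (h4 _ _ id).
(* At [4 i + 2] every factor of [h e] has absolute value at least 2, and [e - i] of them (truncated
   subtraction) are negative. As [2 ^ d >= 4], adding 2 does not change the sign. *)
have hx e i : 2 ^+ e <= (-1) ^+ (e - i) * (map_poly intr (h e)).[(4 * i + 2)%:R] :> R.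
  elim: e => [|e IH].
    by rewrite sub0n expr0 mul1r /h big_ord0 rmorph1 hornerC.
  have -> x : (map_poly intr (h e.+1)).[x] =
      (map_poly intr (h e)).[x] * (x - (4 * e.+1)%:R) :> R.
    rewrite hS rmorphB !rmorphM /= map_polyX map_polyC /= !hornerE -mulrBr.
    by rewrite -[_%:~R]/(_%:R).
  set H := horner _ _ in IH *.
  have p2 : 0 < 2 ^+ e :> R by rewrite exprn_gt0.
  have [ei|ie] := ltnP e i.
    have -> : (e.+1 - i = e - i)%N by lia.
    have : 2 <= (4 * i + 2)%:R - (4 * e.+1)%:R :> R.
      by rewrite -natrB ?ler_nat; lia.
    rewrite exprS mulrA; set c := _ - _ => c2; rewrite mulrC.
    by apply: ler_pM => //; rewrite ltW.
  rewrite subSn // !exprS.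
  have : 2 <= - ((4 * i + 2)%:R - (4 * e.+1)%:R) :> R.
    by rewrite opprB -natrB ?ler_nat; lia.
  set c := _ - _ => c2.
  have -> : -1 * (-1) ^+ (e - i) * (H * c) = - c * ((-1) ^+ (e - i) * H) by ring.
  by apply: ler_pM => //; rewrite ltW.
pose F : {poly R} := map_poly intr f.
have Fx i : 0 < (-1) ^+ (d - i) * F.[(4 * i + 2)%:R].
  rewrite /F rmorphD /= map_polyC /= hornerD hornerC mulrDr.
  have h1 := hx d i.
  have h2 : -2 <= (-1) ^+ (d - i) * 2%:~R :> R.
    by rewrite -signr_odd; case: odd; rewrite ?expr1 ?expr0; lra.
  have h3 : 2 ^+ 2 <= 2 ^+ d :> R by rewrite ler_weXn2l // ler1n.
  by rewrite expr2 in h3; lra.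
have rt (i : 'I_d) : {x : R | x \in `](4 * i + 2)%:R, (4 * i.+1 + 2)%:R[ & root F x}.
  apply: polyrcf.poly_ivtoo; first by rewrite ler_nat; lia.
  have := mulr_gt0 (Fx i) (Fx i.+1).
  have -> : (d - i = (d - i.+1).+1)%N by have := ltn_ord i; lia.
  rewrite exprS; set s := (-1) ^+ _.
  have ss : s * s = 1 by rewrite -expr2 sqrr_sign.
  have -> : forall a b : R, -1 * s * a * (s * b) = - (s * s * (a * b)).
    by move=> a b; ring.
  by rewrite ss mul1r oppr_gt0.
exists f, (fun i => sval (sig_of_sig2 (rt i))); split => //.
- move=> i j; case: (rt i) (rt j) => [x xi _] [y yj _] /= xy.
  move: xi yj; rewrite -xy !in_itv /= => /andP[i1 i2] /andP[j1 j2].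
  have := lt_trans i1 j2; have := lt_trans j1 i2; rewrite !ltr_nat => l1 l2.
  by apply: val_inj => /=; lia.
- move=> i; case: (rt i) => x /=; rewrite in_itv /= => /andP[x1 _] ->; split=> //.
  by apply: le_lt_trans x1; exact: ler0n.
Qed.

Lemma det_Vandermonde_neq0 (R : idomainType) (n : nat) (t : 'I_n -> R) :
  injective t -> \det (Vandermonde n (\row_i t i)) != 0.
Proof.
move=> tI; rewrite det_Vandermonde.
apply/prodf_neq0 => i _; apply/prodf_neq0 => j ij.
by rewrite !mxE subr_eq0; apply/eqP => /tI jiE; rewrite jiE ltnn in ij.
Qed.

(** The product is the norm of [g(theta)]: it is an integer, and it is nonzero because [g], of
    smaller degree than the irreducible [f], is coprime to [f] over the rationals. *)
Lemma irreducible_norm_ge1 (R : numFieldType) (d : nat) (f : {poly int})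
    (theta : 'I_d -> R) :
  f \is monic -> size f = d.+1 -> irreducible_poly f -> injective theta ->
  (forall i, root (map_poly intr f) (theta i)) ->
  forall z : 'I_d -> int, (exists j, z j != 0) ->
  1 <= `|\prod_i \sum_j (z j)%:~R * theta i ^+ j|.
Proof.
move=> fm sf fi thi rf z [j0 zj0].
pose g : {poly int} := \sum_j z j *: 'X^j.
have gE : g = \poly_(j < d) (oapp z 0 (insub j)).
  by rewrite poly_def; apply: eq_bigr => j _; rewrite valK.
have gx i : \sum_j (z j)%:~R * theta i ^+ j = (map_poly intr g).[theta i].
  rewrite /g rmorph_sum /= horner_sum; apply: eq_bigr => j _.
  by rewrite map_polyZ /= map_polyXn hornerZ hornerXn.
have sg : (size g < size f)%N by rewrite sf ltnS gE size_poly.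
have g0 : g != 0.
  apply/eqP => /(congr1 (fun p : {poly int} => p`_j0)); rewrite gE coef_poly ltn_ord valK /= coef0.
  by move/eqP; rewrite (negbTE zj0).
have co : coprimep (map_poly intr f : {poly rat}) (map_poly intr g).
  rewrite irreducible_poly_coprime; last exact/irreducible_rat_int.
  apply/negP => /dvdp_leq.
  rewrite !size_map_inj_poly ?rmorph0 //; try exact: intr_inj.
  by rewrite map_poly_eq0_id0 // ?lead_coef_eq0 ?intr_eq0 ?lead_coef_eq0 // => /(_ g0); rewrite leqNgt sg.
have gn0 i : (map_poly intr g).[theta i] != 0 :> R.
  have := co; rewrite -(coprimep_map (@ratr R)) -!map_poly_comp /=.
  rewrite !(eq_map_poly (fun x => ratr_int R x)) => /coprimep_root; apply; exact: rf.
(* [Z] is the matrix of multiplication by [g] on Z[X]/(f); it is diagonalised by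
   the Vandermonde matrix. *)
pose Z : 'M[int]_d := \matrix_(k, j) (Pdiv.Ring.rmodp ('X^k * g) f)`_j.
pose V := Vandermonde d (\row_i theta i).
have ZV : map_mx intr Z *m V = V *m diag_mx (\row_i (map_poly intr g).[theta i]).
  apply/matrixP => k i; rewrite mul_mx_diag !mxE.
  under eq_bigr do rewrite !mxE.
  set r := Pdiv.Ring.rmodp _ _.
  have sr : (size r <= d)%N by rewrite -ltnS -sf Pdiv.Ring.ltn_rmodp monic_neq0.
  have -> : \sum_(j < d) (r`_j)%:~R * theta i ^+ j = (map_poly intr r).[theta i].
    rewrite (@horner_coef_wide _ d) ?(leq_trans (size_poly _ _)) //.
    by apply: eq_bigr => j _; rewrite coef_map.
  have := Pdiv.RingMonic.rdivp_eq fm ('X^k * g).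
  rewrite -/r => /(congr1 (fun p => (map_poly intr p).[theta i])) /=.
  rewrite rmorphD !rmorphM /= !hornerE map_polyXn hornerXn (rootP (rf i)) mulr0 add0r.
  by move=> <-.
have dV : \det V != 0 by exact: det_Vandermonde_neq0.
have : (\det Z)%:~R = \prod_i (map_poly intr g).[theta i] :> R.
  apply: (mulfI dV); rewrite -det_map_mx mulrC -det_mulmx ZV det_mulmx det_diag.
  by congr (_ * _); apply: eq_bigr => i _; rewrite mxE.
under [in X in _ <= X]eq_bigr do rewrite gx.
move=> dZ; rewrite -dZ -intr_norm ler1z -gtz0_ge1 normr_gt0 -(intr_eq0 R) dZ.
exact/prodf_neq0.
Qed.

Lemma sum_first_two (V : nmodType) (m : nat) (m1 : (1 < m.+1)%N) (F : 'I_m.+1 -> V) :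
  (forall j : 'I_m.+1, (2 <= j)%N -> F j = 0) ->
  \sum_j F j = F ord0 + F (Ordinal m1).
Proof.
move=> F0; rewrite (bigD1 ord0) //= (bigD1 (Ordinal m1)) //= [X in _ + (_ + X)]big1 ?addr0 //.
move=> [j jm]; rewrite -!val_eqE /= => h; apply: F0 => /=; lia.
Qed.

(** * The forms and the size of their product *)

(** [D] stands for [d w] with [d = m + 1], and [T] for the sup norm of [z]. The determinant is only
    nonzero here; rescaling to covolume 1 later changes the constants alone. *)
Lemma exists_matrix_product_bounds (R : realType) (m : nat) (D : R) :
  (2 <= m)%N -> m%:R + 4 <= D ->
  exists B : 'M[R]_m.+1, [/\ \det B != 0,
    exists2 c, 0 < c & forall (z : 'rV[int]_m.+1) (T : nat), z != 0 ->
      (forall i, (`|z 0%R i| <= T)%N) ->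
      c * T%:R `^ (- D) <= \prod_i `|(map_mx intr z *m B) 0 i| &
    exists2 C, 0 < C & forall k, exists (z : 'rV[int]_m.+1) (T : nat),
      [/\ (k < T)%N, forall i, (`|z 0%R i| <= T)%N, exists i, (`|z 0%R i| = T)%N &
      \prod_i `|(map_mx intr z *m B) 0 i| <= C * T%:R `^ (- D)]].
Proof.
move=> m2 Dm.
have m1 : (1 < m.+1)%N by lia.
have mR : 2 <= m%:R :> R by rewrite ler_nat.
have [f [th [fm sf fi thi rf]]] := exists_irreducible_totally_real R m.+1 m1.
(* The exponent is [D + m] because each of the other [m] forms has order [q k] at
   [(p k, q k, 0, ..., 0)]. *)
have [|xi [p [q [pq kq e_bd approx]]]] := exists_approximable_number R (D + m%:R); first lra.
(* [P], read as a vector, is killed by the forms L_2, ..., L_d; [det B <> 0]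
   amounts to [L' P <> 0], which the choice of [a] provides. *)
pose P : {poly R} := \prod_(i < m) ('X - (th (lift ord0 i))%:P).
have sP : size P = m.+1.
  by rewrite /P size_prod_XsubC /index_enum -enumT size_enum_ord.
have [||a [aE av aP]] := exists_generic_form R m
   (fun j => if j == 0%N :> nat then 1 else - xi) (fun j => P`_j) => //.
  have : lead_coef P = 1 by apply/eqP; rewrite -monicE monic_prod_XsubC.
  by rewrite lead_coefE sP.
pose B : 'M[R]_m.+1 := \matrix_(j, i) (if i == ord0 then a j else th i ^+ j).
have Bz (z : 'rV[int]_m.+1) i : (map_mx intr z *m B) 0 i =
    if i == ord0 then \sum_j a j * (z 0 j)%:~R else \sum_j (z 0 j)%:~R * th i ^+ j.
  rewrite !mxE; case: ifP => i0; apply: eq_bigr => j _; rewrite !mxE i0 //.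
  by rewrite mulrC.
pose C1 := \sum_(j < m.+1) `|th ord0 ^+ j|.
have C10 : 0 < C1.
  rewrite /C1 big_ord_recl expr0 normr1; apply: ltr_pwDl => //.
  by apply: sumr_ge0.
(* The full norm is at least 1, and the conjugate left out is at most [C1 * T]. *)
have norm_bd (z : 'rV[int]_m.+1) (T : nat) : z != 0 -> (forall i, (`|z 0%R i| <= T)%N) ->
    (C1 * T%:R)^-1 <= \prod_(i < m.+1 | i != ord0) `|(map_mx intr z *m B) 0 i|.
  move=> z0 zT.
  have ex : exists j, z 0 j != 0.
    apply/existsP; apply: contra_neqT z0; rewrite negb_exists => /forallP h.
    by apply/rowP => j; rewrite mxE; apply/eqP; have := h j; rewrite negbK.
  have T0 : (0 < T)%N by case: ex => j; rewrite -absz_gt0; have := zT j; lia.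
  have := irreducible_norm_ge1 R _ f th fm sf fi thi (fun i => (rf i).2) (fun j => z 0 j) ex.
  rewrite normr_prod (bigD1 ord0) //=.
  under [X in _ * X]eq_bigr => i i0 do [have := Bz z i; rewrite (negbTE i0) => <-].
  have : `|\sum_j (z 0 j)%:~R * th ord0 ^+ j| <= C1 * T%:R.
    apply: le_trans (ler_norm_sum _ _ _) _; rewrite mulr_suml; apply: ler_sum => j _.
    rewrite normrM mulrC; apply: ler_wpM2l => //.
    by rewrite -intr_norm -natr_absz ler_nat.
  set X := `|_|; set Y := \prod_(i | _) _ => XT XY.
  have Y0 : 0 <= Y by apply: prodr_ge0.
  have CT : 0 < C1 * T%:R by rewrite mulr_gt0 // ltr0n.
  rewrite -[leLHS]mul1r ler_pdivrMr // mulrC; apply: le_trans XY _.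
  exact: ler_wpM2r.
(* This is where [m + 4 <= D] enters: it makes the bounds off the exceptional lines strong
   enough. *)
have T_D (T : nat) (e : nat) : (0 < T)%N -> (e <= m.+4)%N ->
    T%:R `^ (- D) <= (T%:R ^+ e)^-1 :> R.
  move=> T0 em; rewrite powRN lef_pV2 ?posrE ?powR_gt0 ?exprn_gt0 ?ltr0n //.
  rewrite -powR_mulrn //; apply: ler_powR; first by rewrite ler1n.
  by apply: le_trans Dm; rewrite -natrD ler_nat; lia.
have x0E (z : 'rV[int]_m.+1) : (forall j : 'I_m.+1, (2 <= j)%N -> z 0 j = 0) ->
    forall F : 'I_m.+1 -> R, \sum_j F j * (z 0 j)%:~R =
      F ord0 * (z 0 ord0)%:~R + F (Ordinal m1) * (z 0 (Ordinal m1))%:~R.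
  by move=> zj F; apply: sum_first_two => j /zj ->; rewrite mulr0.
have Bz0 (z : 'rV[int]_m.+1) : (forall j : 'I_m.+1, (2 <= j)%N -> z 0 j = 0) ->
    (map_mx intr z *m B) 0 ord0 = (z 0 ord0)%:~R - (z 0 (Ordinal m1))%:~R * xi.
  move=> zj; rewrite Bz eqxx x0E // !aE //=; ring.
have Bzi (z : 'rV[int]_m.+1) i : (forall j : 'I_m.+1, (2 <= j)%N -> z 0 j = 0) ->
    i != ord0 ->
    (map_mx intr z *m B) 0 i = (z 0 ord0)%:~R + (z 0 (Ordinal m1))%:~R * th i.
  move=> zj i0; rewrite Bz (negbTE i0).
  under eq_bigr do rewrite mulrC.
  by rewrite x0E // expr0 expr1; ring.
have q0 k : 0 < (q k)%:R :> R by rewrite ltr0n; have := kq k; lia.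
have cardm (x : R) : \prod_(i < m.+1 | i != ord0) x = x ^+ m.
  rewrite prodr_const; congr (_ ^+ _).
  by rewrite (eq_card (B := predC1 ord0)) // cardC1 card_ord.
have qpow k : (q k)%:R `^ (- (D + m%:R)) * (q k)%:R ^+ m = (q k)%:R `^ (- D) :> R.
  rewrite -powR_mulrn ?ltW // -powRD; last by apply/implyP => _; rewrite lt0r_neq0.
  by congr (_ `^ _); ring.
exists B; split.
(* Pairing a kernel vector [v] with the coefficients of [P] kills every column but the first, whence
   [v 0 ord0 = 0]. Elsewhere [B] agrees with the Vandermonde matrix, so [v] is in the kernel of that
   matrix too. *)
- apply/negP; rewrite -det_tr => /det0P[v v0 vB].
  have vBj j : \sum_i v 0 i * B j i = 0.
    have := congr1 (fun M : 'rV[R]_m.+1 => M 0 j) vB; rewrite mxE [RHS]mxE => h.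
    by rewrite -[RHS]h; apply: eq_bigr => i _; rewrite [B^T _ _]mxE.
  have PB i : \sum_(j < m.+1) P`_j * B j i =
      if i == ord0 then \sum_j a j * P`_j else 0.
    case: ifPn => i0.
      by apply: eq_bigr => j _; rewrite mxE i0 mulrC.
    have -> : \sum_(j < m.+1) P`_j * B j i = P.[th i].
      rewrite horner_coef sP; apply: eq_bigr => j _.
      by rewrite mxE (negbTE i0).
    case: (unliftP ord0 i) i0 => [i' ->|->]; last by rewrite eqxx.
    by move=> _; rewrite /P horner_prod (bigD1 i') //= !hornerE subrr mul0r.
  have v00 : v 0 ord0 = 0.
    have : \sum_(j < m.+1) P`_j * (\sum_i v 0 i * B j i) = 0.
      by apply: big1 => j _; rewrite vBj mulr0.
    under eq_bigr do rewrite mulr_sumr.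
    rewrite exchange_big /=.
    have -> : \sum_j \sum_(i < m.+1) P`_i * (v 0 j * B i j) =
        v 0 ord0 * (\sum_j a j * P`_j).
      rewrite (bigD1 ord0) //= [X in _ + X]big1 ?addr0 => [|i i0].
        rewrite -[X in _ * X](PB ord0) mulr_sumr; apply: eq_bigr => i _; ring.
      have := PB i; rewrite (negbTE i0) => h.
      transitivity (v 0 i * \sum_(j < m.+1) P`_j * B j i); last by rewrite h mulr0.
      by rewrite mulr_sumr; apply: eq_bigr => j _; ring.
    by move/eqP; rewrite mulf_eq0 (negbTE av) orbF => /eqP.
  have /negP := det_Vandermonde_neq0 R m.+1 th thi; apply; rewrite -det_tr; apply/det0P; exists v => //.
  apply/rowP => j; rewrite !mxE -[RHS](vBj j); apply: eq_bigr => i _.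
  by rewrite !mxE; case: eqP => // ->; rewrite v00 !mul0r.
(* [c0] serves the [z] with a nonzero entry of index at least 2, [c1] the other [z] off the lines
   through the [(p k, q k)], and [c2] the [z] on these lines. *)
- pose c0 : R := (8 * 3 ^+ m.+1)^-1 / C1.
  pose c1 : R := 32^-1 / C1.
  pose c2 : R := 2^-1 * \prod_(i < m.+1 | i != ord0) th i.
  have c00 : 0 < c0 by rewrite divr_gt0 // invr_gt0 mulr_gt0 // exprn_gt0.
  have c10 : 0 < c1 by rewrite divr_gt0 // invr_gt0.
  have c20 : 0 < c2 by rewrite mulr_gt0 ?invr_gt0 // prodr_gt0 // => i _; exact: (rf i).1.
  exists (Num.min c0 (Num.min c1 c2)); first by rewrite !lt_min c00 c10.
  move=> z T z0 zT.
  have p0 : 0 <= T%:R `^ (- D) :> R by exact: powR_ge0.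
  have T0 : (0 < T)%N.
    rewrite lt0n; apply: contraNneq z0 => TE; apply/eqP/rowP => j; rewrite mxE.
    by apply/eqP; rewrite -absz_eq0 -leqn0; apply: leq_trans (zT j) _; rewrite TE.
  have TR : 0 < T%:R :> R by rewrite ltr0n.
  have nb := norm_bd z T z0 zT.
  rewrite (bigD1 ord0) //=.
  set X := `|_|; set Y := \prod_(i | _) _ in nb *.
  have CT0 : 0 <= (C1 * T%:R)^-1 by rewrite invr_ge0 mulr_ge0 // ltW.
  have [/existsP[j /andP[j2 zj]]|/existsPn zj0] :=
      boolP [exists j : 'I_m.+1, (2 <= j)%N && (z 0 j != 0)].
    have hX : (8 * 3 ^+ m.+1 * T%:R ^+ m.+3)^-1 <= X.
      by rewrite /X Bz eqxx; apply: aP zT; exists j.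
    apply: (@le_trans _ _ (c0 * (T%:R ^+ m.+4)^-1)).
      apply: ler_pM => //; first by rewrite !le_min !ltW.
        by rewrite ge_min lexx.
      exact: T_D.
    apply: (@le_trans _ _ ((8 * 3 ^+ m.+1 * T%:R ^+ m.+3)^-1 * (C1 * T%:R)^-1)).
      by rewrite /c0 [_ ^+ m.+4]exprSr !invfM le_eqVlt; apply/orP; left; apply/eqP; ring.
    apply: ler_pM => //; rewrite invr_ge0 mulr_ge0 ?exprn_ge0 //.
  have zj (j : 'I_m.+1) : (2 <= j)%N -> z 0 j = 0.
    by move=> j2; apply/eqP; have := zj0 j; rewrite j2 negbK.
  have [[k [l [z0E z1E]]]|hX] := approx (z 0 ord0) (z 0 (Ordinal m1)) T (zT _).
    have l0 : l != 0.
      apply: contraNneq z0 => l0; apply/eqP/rowP => j; rewrite mxE.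
      have [/zj //|j2] := leqP 2 j.
      case: j j2 => [[|[|//]] jm] _.
        by rewrite (_ : Ordinal jm = ord0) ?z0E ?l0 ?mul0r //; exact: val_inj.
      by rewrite (_ : Ordinal jm = Ordinal m1) ?z1E ?l0 ?mul0r //; exact: val_inj.
    have l1 : 1 <= `|l%:~R : R| by rewrite -intr_norm ler1z -gtz0_ge1 normr_gt0.
    have qT : (q k <= T)%N.
      apply: leq_trans (zT (Ordinal m1)); rewrite z1E abszM absz_nat.
      by apply: leq_pmull; rewrite absz_gt0.
    have /andP[e1 _] := e_bd k.
    have hX : (q k)%:R `^ (- (D + m%:R)) / 2 <= X.
      rewrite /X Bz0 // z0E z1E !rmorphM /= -!pmulrn.
      have -> : l%:~R * (p k)%:R - l%:~R * (q k)%:R * xi =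
        - (l%:~R * ((q k)%:R * xi - (p k)%:R)) by ring.
      rewrite normrN normrM; apply: le_trans (ler_peMl _ l1) => //.
      by apply: le_trans e1 (ler_norm _).
    (* On the line [L_i] equals [l * (p k + q k * theta_i)]; positivity of [theta_i] excludes
       cancellation. *)
    have hY : (q k)%:R ^+ m * \prod_(i < m.+1 | i != ord0) th i <= Y.
      rewrite -cardm -big_split /=; apply: ler_prod => i i0.
      have t0 := (rf i).1; rewrite mulr_ge0 ?(ltW t0) //=.
      rewrite Bzi // z0E z1E !rmorphM /= -!pmulrn -mulrA -mulrDr normrM.
      apply: le_trans (ler_peMl _ l1) => //.
      by rewrite ger0_norm ?lerDr // addr_ge0 // mulr_ge0 // ltW.
    apply: (@le_trans _ _ (c2 * (q k)%:R `^ (- D))).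
      apply: ler_pM => //; first by rewrite !le_min !ltW.
        by rewrite !ge_min lexx !orbT.
      rewrite !powRN lef_pV2 ?posrE ?powR_gt0 //.
      apply: ge0_ler_powR; rewrite ?nnegrE ?ler_nat //; lra.
    have h0 : 0 <= (q k)%:R `^ (- (D + m%:R)) / 2 :> R by rewrite divr_ge0 ?powR_ge0.
    have h1 : 0 <= (q k)%:R ^+ m * \prod_(i < m.+1 | i != ord0) th i.
      by rewrite mulr_ge0 ?exprn_ge0 // prodr_ge0 // => i _; exact: ltW (rf i).1.
    apply: le_trans (ler_pM h0 h1 hX hY).
    rewrite -qpow /c2 le_eqVlt; apply/orP; left; apply/eqP; ring.
  apply: (@le_trans _ _ (c1 * (T%:R ^+ 3)^-1)).
    apply: ler_pM => //; first by rewrite !le_min !ltW.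
      by rewrite !ge_min lexx !orbT.
    exact: T_D.
  apply: (@le_trans _ _ ((32 * T%:R ^+ 2)^-1 * (C1 * T%:R)^-1)).
    by rewrite /c1 [_ ^+ 3]exprSr !invfM le_eqVlt; apply/orP; left; apply/eqP; ring.
  by rewrite -Bz0 // in hX; apply: ler_pM => //; rewrite invr_ge0 mulr_ge0 ?exprn_ge0.
- exists (2 * \prod_(i < m.+1 | i != ord0) (1 + th i)).
    by rewrite mulr_gt0 // prodr_gt0 // => i _; apply: addr_gt0 => //; exact: (rf i).1.
  (* Since [p k <= q k], the sup norm of this vector is exactly [q k]. *)
  move=> k; pose z : 'rV[int]_m.+1 :=
    \row_j (if j == 0%N :> nat then (p k)%:Z else if j == 1%N :> nat then (q k)%:Z else 0).
  have zj (j : 'I_m.+1) : (2 <= j)%N -> z 0 j = 0.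
    by move=> j2; rewrite mxE !gtn_eqF // ltnW.
  exists z, (q k); split => //.
  - move=> i; rewrite mxE; case: ifP => _; first by rewrite absz_nat.
    by case: ifP => _; rewrite ?absz_nat.
  - by exists (Ordinal m1); rewrite mxE absz_nat.
  have z0E : z 0 ord0 = (p k)%:Z by rewrite mxE.
  have z1E : z 0 (Ordinal m1) = (q k)%:Z by rewrite mxE.
  rewrite (bigD1 ord0) //= Bz0 // z0E z1E -!pmulrn.
  have /andP[e1 e2] := e_bd k.
  have hX : `|(p k)%:R - (q k)%:R * xi| <= 2 * (q k)%:R `^ (- (D + m%:R)).
    rewrite distrC ger0_norm //; apply: le_trans e1; rewrite divr_ge0 //; exact: powR_ge0.
  have hY : \prod_(i < m.+1 | i != ord0) `|(map_mx intr z *m B) 0 i|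
      <= (q k)%:R ^+ m * \prod_(i < m.+1 | i != ord0) (1 + th i).
    rewrite -cardm -big_split /=; apply: ler_prod => i i0; rewrite normr_ge0 /=.
    rewrite Bzi // z0E z1E -!pmulrn.
    have t0 := (rf i).1; rewrite ger0_norm; last by rewrite addr_ge0 // mulr_ge0 // ltW.
    by rewrite mulrDr mulr1 lerD2r ler_nat.
  have := ler_pM (normr_ge0 _) _ hX hY => h; apply: le_trans (h _) _.
    exact: prodr_ge0.
  rewrite -qpow le_eqVlt; apply/orP; left; apply/eqP; ring.
Qed.

(** * From product bounds to the Diophantine exponent *)

Lemma Pi_powR (R : realType) (d : nat) (x : 'rV[R]_d) :
  Pi x = (\prod_(i < d) `|x 0 i|) `^ d%:R^-1.
Proof.
rewrite /Pi; set P := \prod_(i < d) `|x 0 i|.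
suff [] : 0 <= P /\ \prod_(i < d) `|x 0 i| `^ d%:R^-1 = P `^ d%:R^-1 by [].
apply: (big_ind2 (fun u v : R => 0 <= v /\ u = v `^ d%:R^-1)) => //.
- by rewrite powR1.
- by move=> _ v _ v' [v0 ->] [v'0 ->]; rewrite powRM // mulr_ge0.
Qed.

Lemma Pi_eq0 (R : realType) (d : nat) (x : 'rV[R]_d) i : x 0 i = 0 -> Pi x = 0.
Proof.
move=> xi; rewrite /Pi (bigD1 i) //= xi normr0 powR0 ?mul0r //.
by rewrite invr_eq0 pnatr_eq0; case: d {x xi} i => [[]|].
Qed.

Lemma ler_abs_eucl (R : realType) (d : nat) (x : 'rV[R]_d) i : `|x 0 i| <= eucl x.
Proof.
rewrite -sqrtr_sqr; apply: ler_wsqrtr.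
by rewrite (bigD1 i) //= lerDl sumr_ge0 // => j _; rewrite sqr_ge0.
Qed.

Lemma eucl_le_sum (R : realType) (d : nat) (x : 'rV[R]_d) :
  eucl x <= \sum_i `|x 0 i|.
Proof.
have s0 : 0 <= \sum_i `|x 0 i| by apply: sumr_ge0.
rewrite -[leRHS]ger0_norm // -sqrtr_sqr; apply: ler_wsqrtr.
rewrite expr2 mulr_suml; apply: ler_sum => i _.
rewrite -real_normK ?num_real // expr2; apply: ler_wpM2l => //.
by rewrite (bigD1 i) //= lerDl sumr_ge0.
Qed.

(** Applied to a matrix and to its inverse, this makes the sup norm of [z] and the Euclidean norm of
    [z *m B] comparable. *)
Lemma mulmx_eucl_bound (R : realType) (d : nat) (B : 'M[R]_d) :
  exists2 C, 0 < C & forall (x : 'rV[R]_d) (T : R), 0 <= T ->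
    (forall i, `|x 0 i| <= T) -> eucl (x *m B) <= C * T.
Proof.
exists (1 + \sum_i \sum_j `|B j i|).
  by apply: ltr_pwDl => //; apply: sumr_ge0 => i _; apply: sumr_ge0.
move=> x T T0 xT; rewrite mulrDl mul1r; apply: le_trans (eucl_le_sum R d _) _.
rewrite -[leLHS]add0r; apply: lerD => //.
rewrite mulr_suml; apply: ler_sum => i _; rewrite mxE mulr_suml.
apply: le_trans (ler_norm_sum _ _ _) _; apply: ler_sum => j _.
by rewrite normrM mulrC ler_wpM2l.
Qed.

Lemma finite_int_box (d N : nat) :
  finite_set [set z : 'rV[int]_d | forall i, (`|z 0%R i| <= N)%N].
Proof.
pose F (f : {ffun 'I_d -> 'I_(2 * N).+1}) : 'rV[int]_d :=
  \row_i ((f i : nat)%:Z - N%:Z).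
apply: (@sub_finite_set _ _ (F @` setT)); last by apply: finite_image; exact: finite_finset.
move=> z /= zN.
have zb i : (`|(z 0 i + N%:Z)%R| < (2 * N).+1)%N by move: (zN i); lia.
exists [ffun i => Ordinal (zb i)] => //.
apply/rowP => i; rewrite mxE ffunE /=; move: (zN i); lia.
Qed.

Lemma infinite_set_unbounded (R : realType) (T : choiceType) (A : set T) (h : T -> R) :
  (forall k : nat, exists2 x, A x & k%:R < h x) -> ~ finite_set A.
Proof.
move=> Ah /finite_seqP[s sA].
have hs x : x \in s -> h x <= \sum_(y <- s) `|h y|.
  move=> xs; apply: le_trans (ler_norm _) _.
  by rewrite (big_rem x) //= lerDl sumr_ge0.
have [x Ax] := Ah (Num.truncn (\sum_(y <- s) `|h y|)).+1.
rewrite ltNge => /negP; apply.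
apply: le_trans (hs x _) (ltW (truncnS_gt _)).
by move: Ax; rewrite sA.
Qed.

(** As [T] and the Euclidean norm are comparable, the hypotheses pin the order of [Pi] to the power
    [-w] of the norm, and constants are absorbed by any change of the exponent: above [w] only
    bounded [T] remain, below [w] all large [T] of the given sequence qualify. *)
Lemma dioph_exp_of_product_bounds (R : realType) (m : nat) (B : 'M[R]_m.+1) (w : R) :
  0 < w -> \det B != 0 ->
  (exists2 c, 0 < c & forall (z : 'rV[int]_m.+1) (T : nat), z != 0 ->
      (forall i, (`|z 0%R i| <= T)%N) ->
      c * T%:R `^ (- (m.+1%:R * w)) <= \prod_i `|(map_mx intr z *m B) 0 i|) ->
  (exists2 C, 0 < C & forall k, exists (z : 'rV[int]_m.+1) (T : nat),
      [/\ (k < T)%N, forall i, (`|z 0%R i| <= T)%N, exists i, (`|z 0%R i| = T)%N &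
      \prod_i `|(map_mx intr z *m B) 0 i| <= C * T%:R `^ (- (m.+1%:R * w))]) ->
  dioph_exp (lattice B) = w%:E.
Proof.
move=> w0 dB [c c0 lower] [C C0 upper].
have uB : B \in unitmx by rewrite unitmxE unitfE.
have [C1 C10 bd1] := mulmx_eucl_bound R _ B.
have [C2 C20 bd2] := mulmx_eucl_bound R _ (invmx B).
have d0 : 0 < m.+1%:R :> R by [].
have euclT (z : 'rV[int]_m.+1) (T : nat) : (forall i, (`|z 0%R i| <= T)%N) ->
    eucl (map_mx intr z *m B) <= C1 * T%:R.
  move=> zT; apply: bd1 => // i.
  by rewrite mxE -intr_norm -natr_absz ler_nat.
have Teucl (z : 'rV[int]_m.+1) i : (`|z 0%R i|)%:R <= C2 * eucl (map_mx intr z *m B).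
  set x := _ *m B.
  have xz : map_mx intr z = x *m invmx B by rewrite mulmxK.
  have := bd2 x (eucl x) (sqrtr_ge0 _) (ler_abs_eucl _ _ x).
  rewrite -xz; apply: le_trans; apply: le_trans (ler_abs_eucl _ _ _ i).
  by rewrite mxE natr_absz intr_norm.
have powT (K : R) (T : nat) : 0 <= K -> (0 < T)%N ->
    (K * T%:R `^ (- (m.+1%:R * w))) `^ m.+1%:R^-1 = K `^ m.+1%:R^-1 * T%:R `^ (- w).
  move=> K0 T0; rewrite powRM ?powR_ge0 // -powRrM; congr (_ * _ `^ _).
  by field; rewrite lt0r_neq0.
apply/eqP; rewrite eq_le; apply/andP; split.
  apply: ge_ereal_sup => _ [g gS <-]; rewrite lee_fin leNgt; apply/negP => wg.
  apply: gS.
  have g0 : 0 < g by apply: lt_trans wg.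
  (* [K] solves [T ^ (g - w) <= C2 ^ g / c ^ (1 / d)] for [T], the inequality that
     [Pi x <= |x| ^ (- g)] entails. *)
  pose K : R := (C2 `^ g / c `^ m.+1%:R^-1) `^ (g - w)^-1.
  pose N := (Num.truncn K).+1.
  apply: (@sub_finite_set _ _ ((fun z : 'rV[int]_m.+1 => map_mx intr z *m B) @`
     [set z : 'rV[int]_m.+1 | forall i, (`|z 0%R i| <= N)%N])); last first.
    by apply: finite_image; exact: finite_int_box.
  move=> _ [[z ->] xg]; exists z => //= i0.
  pose T := \max_i `|z 0%R i|%N.
  have zT i : (`|z 0%R i| <= T)%N by rewrite /T (bigop.leq_bigmax i).
  apply: leq_trans (zT i0) _.
  have [->//|T0] := posnP T.
  have cT : (0 < #|{: 'I_m.+1}|)%N by rewrite card_ord.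
  have [i1 Ti1] : exists i, (`|z 0%R i| = T)%N.
    by rewrite /T; have [i ->] := @bigop.eq_bigmax _ (fun i => `|z 0%R i|%N) cT; exists i.
  have z0 : z != 0.
    apply: contraTneq T0 => z0; move: Ti1; rewrite z0 mxE absz0 => <-.
    by rewrite ltnn.
  have TR : 0 < T%:R :> R by rewrite ltr0n.
  move: xg; set x := _ *m B; set e := eucl x; rewrite Pi_powR => xg.
  have Te : T%:R <= C2 * e by rewrite -Ti1; exact: Teucl.
  have e0 : 0 < e by rewrite -(pmulr_rgt0 _ C20); exact: lt_le_trans Te.
  have c'0 : 0 < c `^ m.+1%:R^-1 by exact: powR_gt0.
  have h1 : c `^ m.+1%:R^-1 * T%:R `^ (- w) <= e `^ (- g).
    apply: le_trans xg; rewrite -powT ?(ltW c0) //.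
    apply: ge0_ler_powR; rewrite ?nnegrE ?invr_ge0 ?mulr_ge0 ?powR_ge0 ?prodr_ge0 ?(ltW c0) //.
    exact: lower.
  have h2 : T%:R `^ g <= C2 `^ g * e `^ g.
    rewrite -powRM ?(ltW C20) ?(ltW e0) //; apply: ge0_ler_powR;
      rewrite ?nnegrE ?mulr_ge0 ?(ltW g0) ?(ltW C20) ?(ltW e0) //.
  have h3 : T%:R `^ (g - w) <= C2 `^ g / c `^ m.+1%:R^-1.
    rewrite ler_pdivlMr // powRD; last by apply/implyP => _; rewrite lt0r_neq0.
    have eg : 0 < e `^ g by exact: powR_gt0.
    apply: (@le_trans _ _ (T%:R `^ g * e `^ (- g))).
      by rewrite -mulrA; apply: ler_wpM2l; [exact: powR_ge0|rewrite mulrC].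
    by rewrite powRN ler_pdivrMr.
  have TK : T%:R <= K.
    have gw : 0 < g - w by rewrite subr_gt0.
    have := @ge0_ler_powR R (g - w)^-1 _ (T%:R `^ (g - w)) _ _ _ h3.
    rewrite -powRrM divff ?lt0r_neq0 // powRr1 ?(ltW TR) //; apply.
    - by rewrite invr_ge0 ltW.
    - by rewrite nnegrE powR_ge0.
    - by rewrite nnegrE divr_ge0 // powR_ge0.
  by rewrite -(ler_nat R); apply: le_trans TK (ltW (truncnS_gt _)).
apply/lee_addgt0Pr => eps eps0.
(* The cap [w / 2] keeps [g] positive, so that raising to the power [g] is monotone. *)
pose g := w - Num.min eps (w / 2).
have me : Num.min eps (w / 2) <= eps by rewrite ge_min lexx.
have mw : Num.min eps (w / 2) <= w / 2 by rewrite ge_min lexx orbT.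
have m0 : 0 < Num.min eps (w / 2) by rewrite lt_min eps0 divr_gt0.
have g0 : 0 < g by rewrite /g; lra.
have gw : g < w by rewrite /g; lra.
apply: (@le_trans _ _ (g%:E + eps%:E)%E); first by rewrite -EFinD lee_fin /g; lra.
apply: leeD => //; apply: ereal_sup_ubound; exists g => //=.
apply: (@infinite_set_unbounded R _ _ (fun x => C2 * eucl x)) => k.
(* From [T >= K] on, [C ^ (1 / d) * T ^ (- w)] is at most [(C1 * T) ^ (- g)]. *)
pose K : R := (C `^ m.+1%:R^-1 * C1 `^ g) `^ (w - g)^-1.
have [z [T [kT zT [i0 Ti0] zC]]] := upper (k + (Num.truncn K).+1)%N.
have T0 : (0 < T)%N by exact: leq_ltn_trans kT.
have kT1 : (k < T)%N by apply: leq_ltn_trans kT; exact: leq_addr.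
have kT2 : ((Num.truncn K).+1 <= T)%N.
  by apply: leq_trans (ltnW kT); exact: leq_addl.
clear kT.
have TR : 0 < T%:R :> R by rewrite ltr0n.
set x := map_mx intr z *m B in zC.
have Te : T%:R <= C2 * eucl x by rewrite -Ti0; exact: Teucl.
have e0 : 0 < eucl x by rewrite -(pmulr_rgt0 _ C20); exact: lt_le_trans Te.
exists x; last by apply: lt_le_trans Te; rewrite ltr_nat.
split; first by exists z.
have C'0 : 0 < C `^ m.+1%:R^-1 by exact: powR_gt0.
rewrite Pi_powR; apply: (@le_trans _ _ (C `^ m.+1%:R^-1 * T%:R `^ (- w))).
  rewrite -powT ?(ltW C0) //.
  by apply: ge0_ler_powR; rewrite ?nnegrE ?invr_ge0 ?mulr_ge0 ?powR_ge0 ?prodr_ge0 ?(ltW C0).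
have wg : 0 < w - g by rewrite subr_gt0.
have h1 : C `^ m.+1%:R^-1 * C1 `^ g <= T%:R `^ (w - g).
  have KT : K <= T%:R.
    by apply: le_trans (ltW (truncnS_gt _)) _; rewrite ler_nat.
  have := @ge0_ler_powR R (w - g) (ltW wg) K _ _ _ KT.
  rewrite /K -powRrM mulVf ?lt0r_neq0 // powRr1 ?mulr_ge0 ?powR_ge0 //; apply.
  - by rewrite nnegrE powR_ge0.
  - by rewrite nnegrE ltW.
have h2 : eucl x `^ g <= C1 `^ g * T%:R `^ g.
  rewrite -powRM ?(ltW C10) //; apply: ge0_ler_powR;
    rewrite ?nnegrE ?mulr_ge0 ?(ltW g0) ?(ltW e0) ?(ltW C10) //.
  exact: euclT.
have eg : 0 < eucl x `^ g by exact: powR_gt0.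
rewrite [leRHS]powRN -[leRHS]div1r ler_pdivlMr //.
apply: (@le_trans _ _ (C `^ m.+1%:R^-1 * T%:R `^ (- w) * (C1 `^ g * T%:R `^ g))).
  by apply: ler_wpM2l => //; rewrite mulr_ge0 ?powR_ge0.
have -> : C `^ m.+1%:R^-1 * T%:R `^ (- w) * (C1 `^ g * T%:R `^ g) =
    (C `^ m.+1%:R^-1 * C1 `^ g) * T%:R `^ (g - w).
  by rewrite powRD; [ring|apply/implyP => _; rewrite lt0r_neq0].
by rewrite -opprB powRN ler_pdivrMr ?powR_gt0 // mul1r.
Qed.

(** * The value [+oo] and the conclusion *)

(** Multiples of a basis vector have a zero coordinate, so [Pi] vanishes there and the inequality
    holds for every exponent. *)
Lemma dioph_exp_int_lattice (R : realType) (d : nat) : (2 <= d)%N ->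
  dioph_exp (lattice (1%:M : 'M[R]_d)) = +oo%E.
Proof.
move=> d2; have d0 : (0 < d)%N by lia.
pose i0 := Ordinal d0; pose i1 := Ordinal d2.
apply: eq_infty => a.
apply: ereal_sup_ubound; exists a => //=.
apply: (@infinite_set_unbounded R _ _ (fun x => eucl x)) => k.
pose z : 'rV[int]_d := \row_j (if j == i1 then k.+1%:Z else 0).
exists (map_mx intr z).
  split; first by exists z; rewrite mulmx1.
  by rewrite (@Pi_eq0 _ _ _ i0) ?powR_ge0 // !mxE.
apply: lt_le_trans (ler_abs_eucl _ _ _ i1).
by rewrite !mxE eqxx -intr_norm -natr_absz ltr_nat.
Qed.

Theorem theorem1 (R : realType) (d : nat) (hd : (3 <= d)%N) (w : \bar R) :
  ((3 - d%:R / (d%:R - 1) ^+ 2)%:E <= w)%E -> @Omega R d w.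
Proof.
case: w => [w| |] hw; last by [].
  2: by exists 1%:M; rewrite /= ?det1 ?normr1 // dioph_exp_int_lattice // ltnW.
case: d hd hw => [//|m] m2; rewrite lee_fin => hw.
have mR : 2 <= m%:R :> R by rewrite ler_nat.
(* For [m >= 2] the quotient [(m + 1) / m ^ 2] is at most its value 3/4 at [m = 2]; hence
   [w >= 9/4], and [9/4 * (m + 1) >= m + 4]. *)
have hD : m%:R + 4 <= m.+1%:R * w.
  rewrite -[m.+1%:R]natr1 addrK in hw; rewrite -[m.+1%:R]natr1; move: (m%:R) mR hw => x x2 hw.
  have x0 : 0 < x by lra.
  have h : (x + 1) / x ^+ 2 <= 3 / 4.
    by rewrite ler_pdivrMr ?exprn_gt0 // expr2; nra.
  have : x + 1 >= 3 by lra.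
  nra.
have w0 : 0 < w.
  by rewrite -(pmulr_rgt0 _ (ltr0Sn R m)); apply: lt_le_trans hD; lra.
have [B [dB [c c0 lower] [C C0 upper]]] :=
  exists_matrix_product_bounds R m (m.+1%:R * w) m2 hD.
(* Scaling by [s] normalises the covolume to 1 and multiplies every product of coordinates by
   [s ^ d]. *)
pose s : R := `|\det B| `^ (- m.+1%:R^-1).
have dBp : 0 < `|\det B| by rewrite normr_gt0.
have s0 : 0 < s by exact: powR_gt0.
have sd : s ^+ m.+1 = `|\det B|^-1.
  rewrite -powR_mulrn ?ltW // /s -powRrM mulNr mulVf ?pnatr_eq0 //.
  by rewrite powR_inv1 // ltW.
have prodE (z : 'rV[int]_m.+1) : \prod_i `|(map_mx intr z *m (s *: B)) 0 i| =
    s ^+ m.+1 * \prod_i `|(map_mx intr z *m B) 0 i|.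
  rewrite -scalemxAr -[X in _ = X ^+ _ * _]ger0_norm ?ltW //.
  rewrite -[in X in _ ^+ X](card_ord m.+1) -prodr_const -big_split /=.
  by apply: eq_bigr => i _; rewrite mxE normrM.
have sm : 0 < s ^+ m.+1 by exact: exprn_gt0.
have dsB : `|\det (s *: B)| = 1.
  by rewrite detZ normrM (ger0_norm (ltW sm)) sd mulVf ?lt0r_neq0.
exists (s *: B) => //.
apply: dioph_exp_of_product_bounds => //.
- by rewrite -normr_gt0 dsB.
- exists (s ^+ m.+1 * c); first by rewrite mulr_gt0.
  by move=> z T z0 zT; rewrite prodE -mulrA ler_pM2l //; exact: lower.
- exists (s ^+ m.+1 * C); first by rewrite mulr_gt0.
  move=> k; have [z [T [kT zT ziT zC]]] := upper k; exists z, T; split => //.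
  by rewrite prodE -mulrA ler_pM2l.
Qed.
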